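(* Let $\alpha$ be a non-zero algebraic number and write $\bar{\mathcal B}(\alpha)=\{\bar b_1,\ldots,\bar b_N\}$, indexed so that $\bar M(\bar b_1)\le \bar M(\bar b_2)\le\cdots\le \bar M(\bar b_N)$. If $J$ is the smallest index such that $\pi(\alpha)\in\operatorname{span}_{\mathbb Q}\{\bar b_1,\ldots,\bar b_J\}$ (span taken in the $\mathbb Q$-vector space $V$), then $M_\infty(\alpha)=\bar M(\bar b_J)$.
   Context: For a non-zero algebraic number $\gamma$ with minimal polynomial $A\prod_{n=1}^N(x-\gamma_n)$ over $\mathbb Z$ (primitive, $A>0$), its Mahler measure is $M(\gamma)=A\prod_{n=1}^N\max\{1,|\gamma_n|\}$. The ultrametric Mahler measure is $M_\infty(\alpha)=\inf\{\max_{1\le n\le N}M(\alpha_n): N\in\mathbb N,\ \alpha_n\in\overline{\mathbb Q}^\times,\ \alpha=\alpha_1\cdots\alpha_N\}$. Let $V=\overline{\mathbb Q}^\times/\mathrm{Tor}(\overline{\mathbb Q}^\times)$, a vector space over $\mathbb Q$ written multiplicatively, with scalar multiplication $\bar\beta\mapsto\bar\beta^r$ ($r\in\mathbb Q$) induced by taking any $r$-th power; let $\pi:\overline{\mathbb Q}^\times\to V$ be the quotient map. The modified Mahler measure is $\bar M(\beta)=\inf\{M(\zeta\beta):\zeta \text{ a root of unity}\}$; it is well-defined on $V$, and for $\bar\beta\in V$, $\bar M(\bar\beta)=\inf\{M(\beta):\beta\in\pi^{-1}(\bar\beta)\}$. Let $K_\alpha$ be the Galois closure of $\mathbb Q(\alpha)$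 over $\mathbb Q$, $\mathcal B(\alpha)=\{\gamma\in K_\alpha^\times: M(\gamma)\le M(\alpha)\}$ (a finite set), and $\bar{\mathcal B}(\alpha)=\pi(\mathcal B(\alpha))$. *)

(* Defs.v *)
From HB Require Import structures.
From mathcomp Require Import all_boot all_order all_algebra all_field.
From Stdlib Require Import ClassicalEpsilon.
Set Implicit Arguments. Unset Strict Implicit. Unset Printing Implicit Defensive.
Import Order.TTheory GRing.Theory Num.Theory.
Local Open Scope ring_scope.

Definition polyZC (p : {poly int}) : {poly algC} := map_poly (fun z : int => z%:~R) p.
Definition polyZQ (p : {poly int}) : {poly rat} := map_poly (fun z : int => z%:~R) p.

Definition minpolyZ (g : algC) (p : {poly int}) : Prop :=
  [/\ 0 < lead_coef p, zcontents p = 1, irreducible_poly (polyZQ p)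
    & root (polyZC p) g].

Definition Mahler_of (g m : algC) : Prop :=
  exists (p : {poly int}) (rs : seq algC),
    [/\ minpolyZ g p,
        polyZC p = (lead_coef p)%:~R *: \prod_(r <- rs) ('X - r%:P)
      & m = (lead_coef p)%:~R * \prod_(r <- rs) Num.max 1 `|r| ].

(* The Mahler measure as a function (well defined for g <> 0). *)
Definition mahler (g : algC) : algC := epsilon (inhabits 0) (Mahler_of g).

Definition torsion (x : algC) : Prop := exists n : nat, (0 < n)%N /\ x ^+ n = 1.

(* equality in V = Qbar^x / Tor : pi x = pi y *)
Definition equivV (x y : algC) : Prop := torsion (x / y).

(* pi a lies in the Q-span (in V) of pi b_1, ..., pi b_k, i.e.
   n * pi a = sum_j k_j * pi b_j for some n > 0 and integers k_j. *)
Definition in_spanV (a : algC) (bs : seq algC) : Prop :=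
  exists (n : nat) (ks : seq int),
    [/\ (0 < n)%N, size ks = size bs &
        torsion (a ^+ n / \prod_(i < size bs) (bs`_i ^ ks`_i))].

(* g lies in K_a, the Galois closure of Q(a) inside algC, i.e. the
   subfield of algC generated by all conjugates of a (intersection of
   all subfields containing the roots of the minimal polynomial of a). *)
Definition in_Kclosure (a g : algC) : Prop :=
  forall F : pred algC, divring_closed F ->
    (forall (p : {poly int}) (r : algC), minpolyZ a p -> root (polyZC p) r -> r \in F) ->
    g \in F.

Definition Bset (a g : algC) : Prop :=
  [/\ g != 0, in_Kclosure a g & mahler g <= mahler a].

(* Infima of sets of (real algebraic) values.  Since algC is not complete,
   an infimum is represented by its set of (algebraic) lower bounds:
   inf S <= inf T  iff  every lower bound of S is a lower bound of T. *)
Definition lbound (S : algC -> Prop) (y : algC) : Prop := forall s, S s -> y <= s.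
Definition inf_le (S T : algC -> Prop) : Prop := forall y, lbound S y -> lbound T y.
Definition inf_eq (S T : algC -> Prop) : Prop := inf_le S T /\ inf_le T S.

(* values whose infimum is the modified Mahler measure Mbar(b) *)
Definition MbarSet (b : algC) : algC -> Prop :=
  fun m => exists z, torsion z /\ m = mahler (z * b).

(* values whose infimum is the ultrametric Mahler measure M_infty(a) *)
Definition MinfSet (a : algC) : algC -> Prop :=
  fun m => exists s : seq algC,
    [/\ (0 < size s)%N, all (fun x => x != 0) s, a = \prod_(x <- s) x
      & m = \big[Num.max/0]_(x <- s) mahler x].

(* Main.v *)
Require Import Defs.
From HB Require Import structures.
From mathcomp Require Import all_boot all_order all_algebra all_fingroup all_field.
From Stdlib Require Import Classical ClassicalEpsilon.
Set Implicit Arguments. Unset Strict Implicit. Unset Printing Implicit Defensive.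
Import Order.TTheory GRing.Theory Num.Theory.
Local Open Scope ring_scope.

(** If pi(a) lies in the span of b_1, ..., b_J, then a is a root of unity times
    a product of integer powers of n-th roots of the z_j * b_j, for any roots of
    unity z_j; neither n-th roots nor inverses increase the Mahler measure, so
    M_infty(a) <= Mbar(b_J).

    Conversely let a = a_1 ... a_N, let K be the Galois closure of Q(a), and let
    d_i be the norm of a_i from K(a_i) to K.  If A is the leading coefficient of
    the minimal polynomial of a_i over Z, and c runs through the distinct products
    of the orbits of the conjugates of a_i under Gal(Qbar / K), then A * prod (X - c)
    has integer coefficients, whence M(d_i) <= M(a_i).  Taking norms to K shows
    that pi(a) lies in the span of the pi(d_i), so either max M(a_i) >= M(a), or
    all d_i are in B(a) and one of them is equivalent to some b_k with k >= J.

    All infima are compared through their lower bounds, so none of them has to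
    be attained. *)

(** * The Mahler measure of a root of an integer polynomial *)

Definition maxprod (rs : seq algC) : algC := \prod_(r <- rs) Num.max 1 `|r|.

Lemma max1norm_ge1 (r : algC) : 1 <= Num.max 1 `|r|.
Proof. by rewrite comparable_le_max ?lexx // real_comparable ?real1 ?normr_real. Qed.

Lemma max1norm_ge (r : algC) : `|r| <= Num.max 1 `|r|.
Proof. by rewrite comparable_le_max ?lexx ?orbT // real_comparable ?real1 ?normr_real. Qed.

Lemma max1norm_le (r z : algC) : 1 <= z -> `|r| <= z -> Num.max 1 `|r| <= z.
Proof. by rewrite /Order.max; case: ifP. Qed.

Lemma maxprod_cons r rs : maxprod (r :: rs) = Num.max 1 `|r| * maxprod rs.
Proof. by rewrite /maxprod big_cons. Qed.

Lemma maxprod_cat rs ts : maxprod (rs ++ ts) = maxprod rs * maxprod ts.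
Proof. by rewrite /maxprod big_cat. Qed.

Lemma perm_maxprod rs ts : perm_eq rs ts -> maxprod rs = maxprod ts.
Proof. exact: perm_big. Qed.

Lemma maxprod_ge1 rs : 1 <= maxprod rs.
Proof.
elim: rs => [|r rs IH]; first by rewrite /maxprod big_nil.
by rewrite maxprod_cons mulr_ege1 ?max1norm_ge1.
Qed.

Lemma maxprod_ge0 rs : 0 <= maxprod rs.
Proof. exact: le_trans ler01 (maxprod_ge1 _). Qed.

Lemma max1norm_prod_le rs : Num.max 1 `|\prod_(r <- rs) r| <= maxprod rs.
Proof.
apply: max1norm_le; first exact: maxprod_ge1.
rewrite normr_prod /maxprod; apply: ler_prod => r _.
by rewrite normr_ge0 max1norm_ge.
Qed.

Lemma polyZC_QC p : polyZC p = map_poly ratr (polyZQ p).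
Proof. by rewrite /polyZQ -map_poly_comp; apply: eq_map_poly => z /=; rewrite ratr_int. Qed.

Lemma lead_polyZC p : lead_coef (polyZC p) = (lead_coef p)%:~R.
Proof. by rewrite /polyZC lead_coef_map_inj //; apply: intr_inj. Qed.

Lemma polyZC_polyOver P : P \is a polyOver Num.int -> exists Q, P = polyZC Q.
Proof. by case/floorpP => Q ->; exists Q. Qed.

Lemma polyZC_int Q : polyZC Q \is a polyOver Num.int.
Proof. by apply/polyOverP => i; rewrite coef_map /= intr_int. Qed.

(** A common root in [algC] rules out coprimality over the rationals, so the gcd is a non-constant
    divisor of [p], hence associate to [p]. *)
Lemma irreducible_root_dvdp (p q : {poly rat}) (g : algC) :
  irreducible_poly p -> root (map_poly ratr p) g -> root (map_poly ratr q) g -> p %| q.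
Proof.
move=> [_ irrp] pg qg.
have sz : size (gcdp p q) != 1%N.
  apply/negP => sz1.
  have : coprimep (map_poly (ratr : rat -> algC) p) (map_poly ratr q) by rewrite coprimep_map /coprimep sz1.
  by move/coprimep_root/(_ pg); rewrite -rootE qg.
by have := irrp _ sz (dvdp_gcdl p q); move/eqp_dvdl => <-; apply: dvdp_gcdr.
Qed.

(** Gauss's lemma: [p] is primitive, so the quotient of [Q] by [p] over the rationals has integer
    coefficients. *)
Lemma minpolyZ_dvd g p Q :
  minpolyZ g p -> root (polyZC Q) g -> exists R, Q = p * R.
Proof.
case=> lc0 cont irr pg Qg; rewrite !polyZC_QC in pg Qg.
have := irreducible_root_dvdp irr pg Qg; rewrite dvdp_rat_int => /dvdpP_int[R ->]; exists R.
by rewrite [in RHS](zpolyEprim p) cont scale1r.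
Qed.

(** The source of the upper bounds on [mahler]. The integer polynomial with roots [cs] is [p * R],
    and [R] contributes only factors of at least 1: the modulus of its non-zero integer leading
    coefficient and [maxprod] of its roots. *)
Lemma Mahler_of_le (g m B : algC) (cs : seq algC) :
  Mahler_of g m -> B != 0 ->
  B *: \prod_(c <- cs) ('X - c%:P) \is a polyOver Num.int -> g \in cs ->
  m <= `|B| * maxprod cs.
Proof.
case=> p [rs [minp Dp ->]] B0 /polyZC_polyOver [Q DQ] gcs.
have Qg : root (polyZC Q) g by rewrite -DQ rootZ // root_prod_XsubC.
have [R DR] := minpolyZ_dvd minp Qg.
have [ts Dts] := closed_field_poly_normal (polyZC R).
have E : B *: \prod_(c <- cs) ('X - c%:P) =
    ((lead_coef p)%:~R * (lead_coef R)%:~R) *: \prod_(c <- rs ++ ts) ('X - c%:P).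
  rewrite DQ DR /polyZC rmorphM /= -!/(polyZC _) Dp Dts lead_polyZC.
  by rewrite -scalerAl -scalerAr scalerA big_cat.
have DB : B = (lead_coef p)%:~R * (lead_coef R)%:~R.
  by have /(congr1 lead_coef) := E; rewrite !lead_coefZ !lead_coef_prod_XsubC !mulr1.
move: E; rewrite -DB => /(scalerI B0) /prod_XsubC_eq /perm_maxprod ->.
have R0 : lead_coef R != 0.
  by apply: contraNneq B0 => R0; rewrite DB R0 mulr0.
have [lp _ _ _] := minp.
rewrite DB normrM maxprod_cat -/(maxprod rs) [`|(lead_coef p)%:~R|]gtr0_norm ?ltr0z //.
rewrite mulrACA ler_peMr //; first by rewrite mulr_ge0 ?maxprod_ge0 // ler0z ltW.
rewrite mulr_ege1 ?maxprod_ge1 // -intr_norm ler1z.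
by rewrite -gtz0_ge1 normr_gt0.
Qed.

(** The rational minimal polynomial, cleared of denominators and made primitive, serves as [p]; this
    gives the [epsilon] in [mahler] its meaning. *)
Lemma Mahler_of_exists (g : algC) : exists m, Mahler_of g m.
Proof.
have [r [Dr mon_r] dv_r] := minCpolyP g.
have [q0 [a a0 Dq0]] := rat_poly_scale r.
have r0 : r != 0 by rewrite monic_neq0.
have q00 : q0 != 0 by apply: contraNneq r0 => q00; rewrite Dq0 q00 map_poly0 scaler0.
set q := zprimitive q0.
have Dq : polyZQ q %= r.
  rewrite Dq0 (zpolyEprim q0) -/q -[map_poly _ _]/(polyZQ _).
  rewrite /polyZQ map_polyZ scalerA eqp_sym eqp_scale // mulf_neq0 ?invr_eq0 ?intr_eq0 //.
  by rewrite zcontents_eq0.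
have irr_r : irreducible_poly r.
  have rg : root (map_poly ratr r) g by rewrite dv_r.
  split; first by have := size_minCpoly g; rewrite Dr size_map_poly.
  (* As [g] is a root of [t] or of [s], minimality makes [r] divide that factor; if it is [t],
     degrees force [s] to be constant. *)
  move=> s szs /dvdpP [t Dt]; move: rg; rewrite Dt rmorphM rootM !dv_r => /orP[rt|rs]; last first.
    by rewrite /eqp -Dt rs andbT Dt dvdp_mulIr.
  have t0 : t != 0 by apply: contraNneq r0 => t0; rewrite Dt t0 mul0r.
  have s0 : s != 0 by apply: contraNneq r0 => s0; rewrite Dt s0 mulr0.
  have := dvdp_leq t0 rt; rewrite Dt size_mul // => le.
  exfalso; move: szs; rewrite -size_poly_gt0 in s0; rewrite -size_poly_gt0 in t0.
  by move: le s0 t0; case: (size s) => [|[|k]] //; rewrite addnS /= addnC addSn ltnNge leq_addl.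
have cq : zcontents q = 1 by rewrite zcontents_primitive q00.
have [rs Drs] := closed_field_poly_normal (polyZC q).
exists ((lead_coef q)%:~R * maxprod rs), q, rs; split=> //; last by rewrite -lead_polyZC.
split=> //.
- by rewrite -sgz_gt0 sgz_lead_primitive q00.
- have [sz irr] := irr_r; split; first by rewrite (eqp_size Dq).
  by move=> s szs; rewrite (eqp_dvdr _ Dq) => /(irr _ szs) /eqp_trans -> //; rewrite eqp_sym.
- by rewrite polyZC_QC dv_r; have /andP[] := Dq.
Qed.

Lemma mahlerP g : Mahler_of g (mahler g).
Proof.
rewrite /mahler; apply: epsilon_spec; exact: Mahler_of_exists.
Qed.

Lemma Mahler_of_root g p rs :
  minpolyZ g p -> polyZC p = (lead_coef p)%:~R *: \prod_(r <- rs) ('X - r%:P) -> g \in rs.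
Proof.
case=> lc _ _ pg Dp; move: pg; rewrite Dp rootZ ?root_prod_XsubC //.
by rewrite intr_eq0 gt_eqF.
Qed.

Lemma mahler_ge1 g : 1 <= mahler g.
Proof.
have [p [rs [[lc _ _ _] _ ->]]] := mahlerP g.
by rewrite mulr_ege1 ?maxprod_ge1 // ler1z -gtz0_ge1.
Qed.

Lemma mahler_real g : mahler g \is Num.real.
Proof. exact: ger0_real (le_trans ler01 (mahler_ge1 g)). Qed.

Lemma XnsubC_normal n (r : algC) : (0 < n)%N ->
  {cs : seq algC | 'X^n - r%:P = \prod_(c <- cs) ('X - c%:P)}.
Proof.
move=> n0; have [cs Dcs] := closed_field_poly_normal ('X^n - r%:P : {poly algC}).
by exists cs; rewrite {1}Dcs (monicP (monicXnsubC _ n0)) scale1r.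
Qed.

(** [t] is a root of some [X^n - 1], all of whose roots lie on the unit circle. *)
Lemma mahler_torsion t : torsion t -> mahler t <= 1.
Proof.
case=> n [n0 tn].
have [cs Dcs] := XnsubC_normal 1 n0.
have cs1 c : c \in cs -> `|c| = 1.
  move=> ccs; have : root ('X^n - 1%:P) c by rewrite Dcs root_prod_XsubC.
  rewrite /root !hornerE subr_eq0 => /eqP cn.
  by apply/eqP; rewrite -(@pexpr_eq1 _ _ n) // -normrX cn normr1.
have tcs : t \in cs.
  by rewrite -root_prod_XsubC -Dcs /root !hornerE tn subrr.
apply: le_trans (Mahler_of_le (mahlerP t) (oner_neq0 _) _ tcs) _.
  rewrite scale1r -Dcs; apply/polyOverP => i.
  by rewrite coefB coefC -mulrb coefXn rpredB ?rpred_nat.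
rewrite normr1 mul1r /maxprod big_seq big1 // => c /cs1 ->.
by rewrite /Order.max ltxx.
Qed.

(** The [n]-th roots of [r] share one modulus, on the same side of 1 as [|r|]: either every maximum
    is 1, or every maximum is [|c|] and the product of these is [|r|]. *)
Lemma maxprod_roots n (r : algC) (cs : seq algC) :
  (0 < n)%N -> 'X^n - r%:P = \prod_(c <- cs) ('X - c%:P) -> maxprod cs <= Num.max 1 `|r|.
Proof.
move=> n0 Dcs.
have Ecs : `|\prod_(c <- cs) c| = `|r|.
  have /(congr1 (fun p : {poly algC} => `|p.[0]|)) := Dcs.
  rewrite !hornerE expr0n eqn0Ngt n0 sub0r normrN => ->.
  rewrite horner_prod !normr_prod; apply: eq_bigr => c _.
  by rewrite !hornerE normrN.
have cn c : c \in cs -> `|c| ^+ n = `|r|.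
  rewrite -root_prod_XsubC -Dcs /root !hornerE subr_eq0 => /eqP <-.
  by rewrite normrX.
have [r1|r1] := real_leP (normr_real r) (real1 algC).
  rewrite /maxprod big_seq big1 // => c /cn Dc; apply/le_anti.
  by rewrite max1norm_ge1 max1norm_le // -(@expr_le1 _ n) // Dc.
rewrite -Ecs normr_prod /maxprod big_seq [leRHS]big_seq.
apply: ler_prod => c /cn Dc; rewrite (le_trans ler01 (max1norm_ge1 _)) /=.
apply: max1norm_le => //; rewrite -(@expr_ge1 _ n) // Dc; exact: ltW.
Qed.

(** [p(X^n)] has integer coefficients, the leading coefficient of [p], and as roots the [n]-th roots
    of the roots of [p]. *)
Lemma mahler_exp_ge n g h : (0 < n)%N -> g ^+ n = h -> mahler g <= mahler h.
Proof.
move=> n0 Dh; have [p [rs [minp Dp ->]]] := mahlerP h.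
have hrs := Mahler_of_root minp Dp; case: minp => lc _ _ _.
pose rt (r : algC) := sval (XnsubC_normal r n0).
have rtP r : 'X^n - r%:P = \prod_(c <- rt r) ('X - c%:P).
  by rewrite /rt; case: XnsubC_normal.
pose cs := flatten (map rt rs).
have gcs : g \in cs.
  apply/flattenP; exists (rt h); first exact: map_f.
  by rewrite -root_prod_XsubC -rtP /root !hornerE Dh subrr.
have Dcs : (lead_coef p)%:~R *: \prod_(c <- cs) ('X - c%:P) = polyZC (p \Po 'X^n).
  rewrite /polyZC map_comp_poly map_polyXn -/(polyZC p) Dp comp_polyZ; congr (_ *: _).
  rewrite /cs; elim: (rs) => [|r s IH] /=; first by rewrite !big_nil comp_polyC.
  by rewrite big_cat big_cons comp_polyM /= -IH comp_polyB comp_polyX comp_polyC -rtP.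
have lc0 : (lead_coef p)%:~R != 0 :> algC by rewrite intr_eq0 gt_eqF.
apply: le_trans (Mahler_of_le (mahlerP g) lc0 _ gcs) _; first by rewrite Dcs polyZC_int.
rewrite gtr0_norm ?ltr0z // ler_pM2l ?ltr0z // -/(maxprod rs) /cs.
elim: (rs) => [|r s IH] //=; rewrite maxprod_cat maxprod_cons.
by rewrite ler_pM ?maxprod_ge0 // (maxprod_roots n0 (rtP r)).
Qed.

(** The reciprocal polynomial [X^n q(1/X)], with [n] in the role of the degree of [q]. *)
Definition revp n (q : {poly algC}) : {poly algC} := \poly_(i < n.+1) q`_(n - i).

Lemma revp_XsubC_mul n (r : algC) (q : {poly algC}) : (size q <= n.+1)%N ->
  revp n.+1 (('X - r%:P) * q) = (1 - r *: 'X) * revp n q.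
Proof.
move=> sq; apply/polyP => i; rewrite coef_poly !mulrBl -scalerAl mul1r !coefB coefZ !coefXM coefCM.
rewrite !coef_poly; case: i => [|i] /=.
  by rewrite !subn0 [q`_n.+1]nth_default // mulr0.
rewrite subSS !ltnS; have [lein|ltni] := leqP i n; last by rewrite ltnNge ltnW //= mulr0 subr0.
have [ltin|] := ltnP i n; first by rewrite subn_eq0 leqNgt ltin /= subnS.
by rewrite leq_eqVlt ltnNge lein orbF => /eqP <-; rewrite subnn.
Qed.

Lemma revp_prod_XsubC (rs : seq algC) :
  revp (size rs) (\prod_(r <- rs) ('X - r%:P)) = \prod_(r <- rs) (1 - r *: 'X).
Proof.
elim: rs => [|r rs IH] /=.
  by rewrite !big_nil; apply/polyP=> i; rewrite coef_poly !coefC; case: i => [|i].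
by rewrite !big_cons revp_XsubC_mul ?IH // size_prod_XsubC.
Qed.

(** The reciprocal of [p] has the inverses of the roots of [p] as its roots, and
    [|r| max(1, 1/|r|) <= max(1, |r|)] holds factor by factor. *)
Lemma mahler_inv (g : algC) : g != 0 -> mahler g^-1 <= mahler g.
Proof.
move=> g0; have [p [rs [minp Dp ->]]] := mahlerP g.
have grs := Mahler_of_root minp Dp.
(* A zero root would make the irreducible [p] divide [X], and then [g] would be 0. *)
have rs0 : all (fun r => r != 0) rs.
  apply/allP => r rrs; apply: contraNneq g0 => r0.
  have [lc _ irr pg] := minp; rewrite polyZC_QC in pg.
  have p0 : root (polyZQ p) 0.
    rewrite -(fmorph_root (@ratr algC)) rmorph0 -polyZC_QC Dp.
    by rewrite rootZ ?intr_eq0 ?gt_eqF // root_prod_XsubC -r0.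
  have p0' : root (map_poly (@ratr algC) 'X) 0 by rewrite map_polyX /root hornerX.
  have : polyZQ p %| 'X.
    apply: (@irreducible_root_dvdp _ _ 0) => //.
    by rewrite -(rmorph0 (@ratr algC)) fmorph_root.
  rewrite -(dvdp_map (@ratr algC)) map_polyX => /dvdpP[q Dq].
  by rewrite -[g]hornerX Dq hornerM (eqP pg) mulr0.
(* [B] is [p(0)], the leading coefficient of the reciprocal polynomial. *)
pose B := (lead_coef p)%:~R * \prod_(r <- rs) (- r).
pose cs := [seq r^-1 | r <- rs].
have lc0 : (lead_coef p)%:~R != 0 :> algC by case: minp => lc _ _ _; rewrite intr_eq0 gt_eqF.
have B0 : B != 0.
  rewrite mulf_neq0 // prodf_seq_neq0; apply: sub_all rs0 => r /=; by rewrite oppr_eq0.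
have DB : B *: \prod_(c <- cs) ('X - c%:P) = revp (size rs) (polyZC p).
  have -> : revp (size rs) (polyZC p) =
      (lead_coef p)%:~R *: revp (size rs) (\prod_(r <- rs) ('X - r%:P)).
    rewrite Dp; apply/polyP=> i; rewrite coefZ !coef_poly coefZ.
    by case: ifP; rewrite ?mulr0.
  rewrite revp_prod_XsubC /B -scalerA; congr (_ *: _).
  rewrite /cs; elim: (rs) rs0 => [|r s IH] /=; first by rewrite !big_nil scale1r.
  case/andP=> r0 /IH Ds; rewrite !big_cons -Ds -scalerA -scalerAr scalerA mulrC -scalerA.
  rewrite scalerAl; congr (_ *: (_ * _)).
  by rewrite scalerBr !scaleNr opprK addrC -[r *: _%:P]mul_polyC -polyCM divff.
have gcs : g^-1 \in cs by apply: map_f.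
apply: le_trans (Mahler_of_le (mahlerP g^-1) B0 _ gcs) _.
  rewrite DB; apply/polyOverP => i; rewrite coef_poly; case: ifP => _; last exact: rpred0.
  exact: (polyOverP (polyZC_int p)).
rewrite /B normrM -mulrA gtr0_norm; last by case: minp => lc _ _ _; rewrite ltr0z.
rewrite ler_pM2l; last by case: minp => lc _ _ _; rewrite ltr0z.
rewrite -/(maxprod rs) /cs; elim: (rs) rs0 => [|r s IH] /=.
  by rewrite /maxprod !big_nil normr1 mul1r.
case/andP=> r0 /IH Ds; rewrite big_cons !maxprod_cons normrM mulrACA.
apply: ler_pM => //; rewrite ?mulr_ge0 ?maxprod_ge0 // ?(le_trans ler01 (max1norm_ge1 _)) //.
rewrite normrN normfV /Order.max; case: ifP => _; first by rewrite divff ?normr_eq0 // max1norm_ge1.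
by rewrite mulr1 max1norm_ge.
Qed.

(** * Roots of unity *)

Lemma torsion_neq0 t : torsion t -> t != 0.
Proof.
by case=> n [n0]; apply: contra_eq_neq => ->; rewrite expr0n gtn_eqF // eq_sym oner_neq0.
Qed.

Lemma torsion1 : torsion 1. Proof. by exists 1%N; rewrite expr1n. Qed.

Lemma torsionM s t : torsion s -> torsion t -> torsion (s * t).
Proof.
case=> m [m0 sm] [n [n0 tn]]; exists (m * n)%N; rewrite muln_gt0 m0 n0; split=> //.
by rewrite exprMn exprM sm expr1n mulnC exprM tn expr1n mul1r.
Qed.

Lemma torsionX t n : torsion t -> torsion (t ^+ n).
Proof.
case=> m [m0 tm]; exists m; split=> //.
by rewrite -exprM mulnC exprM tm expr1n.
Qed.

Lemma torsionV t : torsion t -> torsion t^-1.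
Proof. by case=> m [m0 tm]; exists m; rewrite exprVn tm invr1. Qed.

Lemma torsion_root t n : (0 < n)%N -> torsion (t ^+ n) -> torsion t.
Proof.
by move=> n0 [m [m0 tm]]; exists (n * m)%N; rewrite muln_gt0 n0 exprM.
Qed.

(** * Products of roots and algebraic integers *)

Definition Aint_poly (p : {poly algC}) := forall i, p`_i \in Aint.

(* Equivalently, A times the product of any subfamily of rs is an algebraic
   integer, a property which grouping or dropping members of rs preserves. *)
Definition Aint_split (A : algC) (rs : seq algC) :=
  Aint_poly (A *: \prod_(r <- rs) ('X - r%:P)).

Lemma Aint_integral (z : algC) : z \in Aint -> integralOver (intr : int -> algC) z.
Proof.
rewrite unfold_in => /floorpP[q Dq]; exists q; last by rewrite -Dq root_minCpoly.
have := minCpoly_monic z; rewrite Dq !monicE lead_coef_map_inj //; last exact: intr_inj.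
by rewrite -[1]/(1%:~R) eqr_int.
Qed.

Lemma integral_Aint (z : algC) : integralOver (intr : int -> algC) z -> z \in Aint.
Proof.
case=> q mon_q qz; apply: (root_monic_Aint qz).
  by rewrite monicE lead_coef_map_inj ?(monicP mon_q) //; apply: intr_inj.
by apply/polyOverP => i; rewrite coef_map /= intr_int.
Qed.

(** For [p] of degree [n + 1] and leading coefficient [A], the monic [q] with [q(A X) = A^n p(X)]
    has integral coefficients and vanishes at [A r]; integrality is transitive. *)
Lemma Aint_lead_root p r : Aint_poly p -> root p r -> lead_coef p * r \in Aint.
Proof.
move=> Ap pr; have [p0|p0] := eqVneq p 0.
  by rewrite p0 lead_coef0 mul0r rpred0.
pose A := lead_coef p; have szp : (1 < size p)%N by apply: root_size_gt1 pr.
pose n := (size p).-2; have Dn : size p = n.+2 by rewrite /n; case: (size p) szp => [|[|]].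
pose q : {poly algC} := 'X^(n.+1) + \poly_(i < n.+1) (p`_i * A ^+ (n - i)).
have sz : (size (\poly_(i < n.+1) (p`_i * A ^+ (n - i))%R) < size ('X^(n.+1) : {poly algC}))%N.
  by rewrite size_polyXn ltnS size_poly.
have Aq i : q`_i \in Aint.
  rewrite coefD coefXn rpredD ?rpred_nat // coef_poly; case: ifP => _; last exact: rpred0.
  by rewrite rpredM ?rpredX ?Ap // /A lead_coefE Ap.
apply/integral_Aint/(@integral_root_monic _ _ intr _ q).
- by rewrite monicE /q lead_coefDl // lead_coefXn.
- suff E : q.[A * r] = A ^+ n * p.[r] by rewrite /root E (eqP pr) mulr0.
  rewrite [p.[r]]horner_coef Dn big_ord_recr /= /q hornerD hornerXn horner_poly -/A.
  have DA : A = p`_n.+1 by rewrite /A lead_coefE Dn.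
  rewrite mulrDr -DA addrC mulr_sumr; congr (_ + _).
    apply: eq_bigr => i _; rewrite exprMn [LHS]mulrA -[_ * _ * A ^+ i]mulrA -exprD.
    by rewrite subnK -1?ltnS // -mulrA mulrCA.
  by rewrite exprMn exprSr mulrA.
- by move=> _ /(nthP 0)[i _ <-]; apply/Aint_integral/Aq.
Qed.

(** Induction on the size of [q]: by [Aint_lead_root] both [A] and [A r] are integral, so the
    leading term [A X^n] of [q] can be subtracted while the hypothesis is kept. *)
Lemma Aint_poly_divXsubC r q : Aint_poly (('X - r%:P) * q) -> Aint_poly q.
Proof.
have [k] := ubnP (size q); elim: k q => // k IH q; rewrite ltnS => szq Aq.
have [q0|q0] := eqVneq q 0; first by move=> i; rewrite q0 coef0 rpred0.
have [n Dn] : exists n, size q = n.+1 by exists (size q).-1; rewrite prednK // size_poly_gt0.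
pose A := lead_coef q.
have DA : lead_coef (('X - r%:P) * q) = A.
  by rewrite lead_coefM lead_coefXsubC mul1r.
have AA : A \in Aint by rewrite -DA lead_coefE Aq.
have Ar : A * r \in Aint.
  by rewrite -DA; apply: Aint_lead_root; rewrite // rootM root_XsubC eqxx.
have Aq' : Aint_poly (q - A *: 'X^n).
  apply: IH.
    apply: leq_trans szq; rewrite Dn ltnS; apply/leq_sizeP => j; rewrite leq_eqVlt.
    rewrite coefB coefZ coefXn => /orP[/eqP <-|ltnj].
      by rewrite eqxx mulr1 /A lead_coefE Dn subrr.
    by rewrite gtn_eqF // mulr0 subr0 nth_default // Dn.
  move=> i; rewrite mulrBr coefB rpredB ?Aq // -scalerAr coefZ mulrBl coefB.
  rewrite -exprS coefXn coefCM coefXn mulrBr mulrA.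
  by rewrite rpredB // rpredM ?rpred_nat.
move=> i; rewrite -[q](subrK (A *: 'X^n)) coefD rpredD ?Aq' //.
by rewrite coefZ coefXn rpredM ?rpred_nat.
Qed.

(** The identity [(X - r) P = X P - r P] gives one direction; the other first divides by [X - r].
    Each root may thus be dropped or multiplied into [A]. *)
Lemma Aint_split_cons A r rs :
  Aint_split A (r :: rs) <-> Aint_split A rs /\ Aint_split (A * r) rs.
Proof.
have E : A *: \prod_(x <- r :: rs) ('X - x%:P) =
    'X * (A *: \prod_(x <- rs) ('X - x%:P)) - (A * r) *: \prod_(x <- rs) ('X - x%:P).
  by rewrite big_cons mulrBl scalerBr -scalerAr mul_polyC scalerA.
split=> [Ars|[Ars Ar]]; last first.
  move=> i; rewrite E coefB coefXM rpredB //.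
  by case: ifP => _; [apply: rpred0 | apply: Ars].
have As : Aint_split A rs.
  by apply: (@Aint_poly_divXsubC r); move: Ars; rewrite /Aint_split big_cons scalerAr.
split=> // i; have := Ars i; rewrite E coefB => H.
rewrite -[X in X \in _](subKr ('X * (A *: \prod_(x <- rs) ('X - x%:P)))`_i) rpredB //.
by rewrite coefXM; case: ifP => _; [apply: rpred0 | apply: As].
Qed.

Lemma perm_Aint_split A rs ts : perm_eq rs ts -> Aint_split A rs -> Aint_split A ts.
Proof. by move=> prt; rewrite /Aint_split (perm_big _ prt). Qed.

Lemma Aint_split_cat A rs ts :
  Aint_split A (rs ++ ts) -> Aint_split A ts /\ Aint_split (A * \prod_(r <- rs) r) ts.
Proof.
elim: rs A => [|r rs IH] A /=; first by rewrite big_nil mulr1.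
by case/Aint_split_cons => /IH[At _] /IH[_]; rewrite big_cons mulrA.
Qed.

Lemma Aint_split_flatten A gs :
  Aint_split A (flatten gs) -> Aint_split A [seq \prod_(r <- s) r | s <- gs].
Proof.
elim: gs A => [|s gs IH] A //= /Aint_split_cat[AS ASt].
by apply/Aint_split_cons; split; apply: IH.
Qed.

Lemma Aint_split_undup A rs : Aint_split A rs -> Aint_split A (undup rs).
Proof.
elim: rs A => [|r rs IH] A //= /Aint_split_cons[As Ar].
by case: ifP => _; [|apply/Aint_split_cons; split]; apply: IH.
Qed.

Lemma maxprod_flatten gs : maxprod [seq \prod_(r <- s) r | s <- gs] <= maxprod (flatten gs).
Proof.
elim: gs => [|s gs IH] //=; rewrite maxprod_cons maxprod_cat.
by rewrite ler_pM ?maxprod_ge0 ?max1norm_prod_le // (le_trans ler01 (max1norm_ge1 _)).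
Qed.

Lemma maxprod_undup rs : maxprod (undup rs) <= maxprod rs.
Proof.
elim: rs => [|r rs IH] //=; case: ifP => _; rewrite !maxprod_cons.
  by rewrite (le_trans IH) // ler_peMl ?maxprod_ge0 ?max1norm_ge1.
by rewrite ler_wpM2l // (le_trans ler01 (max1norm_ge1 _)).
Qed.

(** * Norms to the Galois closure *)

(** In characteristic zero the derivative is non-zero and of smaller degree, so [p] cannot divide
    it. *)
Lemma irreducible_separable (p : {poly rat}) : irreducible_poly p -> separable_poly p.
Proof.
case=> szp irr; rewrite separable_poly.unlock /coprimep; apply: contraTT isT => sz.
have := irr _ sz (dvdp_gcdl _ _) => /eqp_dvdl E.
have : p %| p^`() by rewrite -E dvdp_gcdr.
have p0 : p != 0 by rewrite -size_poly_gt0 (ltn_trans _ szp).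
have d0 : p^`() != 0.
  apply: contraNneq p0 => /(congr1 (fun q : {poly rat} => q`_(size p).-2)).
  rewrite coef_deriv coef0 -lead_coef_eq0 lead_coefE => /eqP.
  by rewrite mulrn_eq0 /=; case: (size p) szp => [|[|]].
by move/(dvdp_leq d0); rewrite leqNgt lt_size_deriv.
Qed.

Lemma minpolyZ_uniq_roots g p rs B :
  minpolyZ g p -> polyZC p = B *: \prod_(r <- rs) ('X - r%:P) -> uniq rs.
Proof.
case=> lc _ irr _ Dp; have B0 : B != 0.
  apply: contraTneq lc => B0; rewrite B0 scale0r in Dp.
  by rewrite -(ltr0z algC) -lead_polyZC Dp lead_coef0 ltxx.
have := irreducible_separable irr.
rewrite -(separable_map (@ratr algC)) -polyZC_QC Dp.
by rewrite (eqp_separable (eqp_scale _ B0)) separable_prod_XsubC.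
Qed.

(** [epsilon] fixes one list of conjugates that also computes [mahler g]. *)
Definition conjugate_seq (g : algC) : seq algC :=
  epsilon (inhabits [::]) (fun rs => exists p,
    [/\ minpolyZ g p, polyZC p = (lead_coef p)%:~R *: \prod_(r <- rs) ('X - r%:P)
      & mahler g = (lead_coef p)%:~R * maxprod rs]).

Lemma conjugate_seqP (g : algC) : exists p,
  [/\ minpolyZ g p, polyZC p = (lead_coef p)%:~R *: \prod_(r <- conjugate_seq g) ('X - r%:P)
    & mahler g = (lead_coef p)%:~R * maxprod (conjugate_seq g)].
Proof.
have [p0 [rs H]] := mahlerP g.
pose P rs := exists p,
  [/\ minpolyZ g p, polyZC p = (lead_coef p)%:~R *: \prod_(r <- rs) ('X - r%:P)
    & mahler g = (lead_coef p)%:~R * maxprod rs].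
by apply: (epsilon_spec (inhabits [::]) P); exists rs, p0.
Qed.

Lemma mem_conjugate_seq g : g \in conjugate_seq g.
Proof. by have [p [minp Dp _]] := conjugate_seqP g; apply: Mahler_of_root minp Dp. Qed.

Lemma uniq_conjugate_seq g : uniq (conjugate_seq g).
Proof. by have [p [minp Dp _]] := conjugate_seqP g; apply: minpolyZ_uniq_roots minp Dp. Qed.

(** * Number fields embedded in [algC] *)

Section NumberField.

Variables (L : fieldExtType rat) (iota : {rmorphism L -> algC}).

Lemma iota_alg (k : rat) : iota k%:A = ratr k.
Proof. by rewrite alg_num_field fmorph_rat. Qed.

Lemma Crat_mem1 c : (c \in 1%VS) = (iota c \in Crat).
Proof.
apply/vlineP/CratP => [[k ->]|[k Dk]]; exists k; first exact: iota_alg.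
by apply: (fmorph_inj iota); rewrite Dk iota_alg.
Qed.

Lemma conjugate_seq_polyOver1 g ts :
  map iota ts = conjugate_seq g -> \prod_(t <- ts) ('X - t%:P) \is a polyOver 1%VS.
Proof.
move=> Dts; apply/polyOverP => i; rewrite Crat_mem1 -coef_map map_prod_XsubC -(big_map iota xpredT (fun r => 'X - r%:P)) Dts.
have [p [[lc _ _ _] Dp _]] := conjugate_seqP g.
have lc0 : (lead_coef p)%:~R != 0 :> algC by rewrite intr_eq0 gt_eqF.
have -> : \prod_(r <- conjugate_seq g) ('X - r%:P) = (lead_coef p)%:~R^-1 *: polyZC p.
  by rewrite Dp scalerA mulVf // scale1r.
by rewrite coefZ coef_map /= rpredM ?rpredV ?rpred_int.
Qed.

(** [in_Kclosure] quantifies over all subfields [F] of [algC]; this transfers membership in a field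
    generated inside [L] to each of them. *)
Lemma divring_closed_adjoin (F : pred algC) (ts : seq L) :
  divring_closed F -> {in ts, forall t, iota t \in F} ->
  {in <<1 & ts>>%VS, forall x, iota x \in F}.
Proof.
case=> F1 FB FD.
have F0 : 0 \in F by rewrite -(subrr 1) FB.
have FN x : x \in F -> - x \in F by move=> Fx; rewrite -sub0r FB.
have FA x y : x \in F -> y \in F -> x + y \in F by move=> Fx Fy; rewrite -[y]opprK FB ?FN.
have FV x : x \in F -> x^-1 \in F by move=> Fx; rewrite -div1r FD.
have FM x y : x \in F -> y \in F -> x * y \in F by move=> Fx Fy; rewrite -[y]invrK FD ?FV.
have Fn n : n%:R \in F by elim: n => // n IH; rewrite -addn1 natrD FA.
have Fz (z : int) : z%:~R \in F by case: z => n; rewrite ?NegzE ?rmorphN ?FN ?Fn //; apply: Fn.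
elim/last_ind: ts => [|ts t IH] Fts x.
  rewrite adjoin_nil (subfield_closed 1%AS) => /vlineP[k ->].
  by rewrite iota_alg FM ?FV.
rewrite adjoin_rcons => /Fadjoin_polyP[p /polyOverP Kp ->].
rewrite horner_coef rmorph_sum; elim/big_ind: _ => // i _.
have Ft : iota t \in F by apply: Fts; rewrite mem_rcons mem_head.
rewrite rmorphM rmorphXn FM //; last by elim: (nat_of_ord i) => // n In; rewrite exprS FM.
by apply: IH (Kp i) => r rts; apply: Fts; rewrite mem_rcons inE rts orbT.
Qed.

End NumberField.

Lemma uniq_flatten (T : eqType) (gs : seq (seq T)) :
  uniq gs -> (forall s, s \in gs -> uniq s) ->
  (forall s t x, s \in gs -> t \in gs -> x \in s -> x \in t -> s = t) ->
  uniq (flatten gs).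
Proof.
elim: gs => //= s gs IH /andP[sgs ugs] us dj; rewrite cat_uniq us ?mem_head //=.
rewrite IH // => [|t tgs|t1 t2 x t1g t2g]; last 2 first.
- by apply: us; rewrite inE tgs orbT.
- by apply: dj; rewrite inE ?t1g ?t2g orbT.
rewrite andbT; apply/hasPn => x /flattenP[t tgs xt]; apply: contra sgs => xs.
by rewrite (dj s t x) ?mem_head // inE tgs orbT.
Qed.

(** * Orbits of conjugates under a normal subgroup of the Galois group *)

Section Galois.

Variables (L : splittingFieldType rat) (iota : {rmorphism L -> algC}).
Hypothesis galL : galois 1 {:L}.

Local Notation G := ('Gal({:L} / 1))%g.

Lemma galM_full (s t : gal_of {:L}) (x : L) : (s * t)%g x = t (s x).
Proof. exact: galM (memvf x). Qed.

Lemma gal_conjugate_seq g (ts : seq L) (s : gal_of {:L}) (t : L) :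
  map iota ts = conjugate_seq g -> s \in G -> t \in ts -> s t \in ts.
Proof.
move=> Dts sG; have P1 := conjugate_seq_polyOver1 Dts.
rewrite -!root_prod_XsubC => tr.
rewrite -[X in root X _](fixedPoly_gal (sub1v _) sG P1).
by rewrite fmorph_root.
Qed.

Lemma perm_map_gal (s : gal_of {:L}) (cs : seq L) :
  uniq cs -> {in cs, forall c, s c \in cs} -> perm_eq (map s cs) cs.
Proof.
move=> ucs scs; have um : uniq (map s cs) by rewrite map_inj_uniq //; apply: fmorph_inj.
apply: uniq_perm => //.
have sub : {subset map s cs <= cs} by move=> _ /mapP[c ccs ->]; apply: scs.
by have [] := uniq_min_size um sub; first by rewrite size_map.
Qed.

Lemma gal_stable_polyOver1 (cs : seq L) :
  uniq cs -> {in G, forall s : gal_of {:L}, {in cs, forall c, s c \in cs}} ->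
  \prod_(c <- cs) ('X - c%:P) \is a polyOver 1%VS.
Proof.
move=> ucs Gcs; apply/polyOverP => i; rewrite -(galois_fixedField galL).
apply/fixedFieldP => [|s sG]; first exact: memvf.
by rewrite -coef_map map_prod_XsubC -(big_map s xpredT (fun r => 'X - r%:P)) (perm_big _ (perm_map_gal ucs (Gcs s sG))).
Qed.

Variables (K : {subfield L}).
Local Notation H := ('Gal({:L} / K))%g.
Hypothesis nHG : (H <| G)%g.

(** Cutting the orbit out of a list [ts] of conjugates makes equal orbits equal as lists and keeps
    them free of repetition. *)
Definition orbit_in (ts : seq L) (r : L) : seq L :=
  [seq t <- ts | [exists h in H, (h : gal_of {:L}) r == t]].

Lemma mem_orbit_in ts r t :
  reflect (t \in ts /\ exists2 h : gal_of {:L}, h \in H & h r = t) (t \in orbit_in ts r).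
Proof.
rewrite mem_filter andbC; apply: (iffP andP) => -[tts].
  by case/exists_inP=> h hH /eqP Dt; split=> //; exists h.
by case=> h hH Dt; split=> //; apply/exists_inP; exists h => //; apply/eqP.
Qed.

Lemma orbit_in_refl ts r : r \in ts -> r \in orbit_in ts r.
Proof. by move=> rts; apply/mem_orbit_in; split=> //; exists 1%g; rewrite ?group1 ?gal_id. Qed.

Lemma orbit_in_eq ts r h : h \in H -> orbit_in ts (h r) = orbit_in ts r.
Proof.
move=> hH; apply: eq_filter => t; apply/exists_inP/exists_inP => -[k kH /eqP <-].
  by exists (h * k)%g; rewrite ?groupM // galM_full.
by exists (h^-1 * k)%g; rewrite ?groupM ?groupV // -galM_full mulKVg.
Qed.

(** By normality, [s (h r) = (h ^ s) (s r)] with [h ^ s] again in [H]. *)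
Lemma perm_map_orbit_in ts (s : gal_of {:L}) r :
  uniq ts -> {in G, forall s : gal_of {:L}, {in ts, forall t, s t \in ts}} -> s \in G ->
  perm_eq (map s (orbit_in ts r)) (orbit_in ts (s r)).
Proof.
move=> uts Gts sG.
have sHG : H \subset G := normal_sub nHG.
have sN : s \in 'N(H)%g := subsetP (normal_norm nHG) s sG.
apply: uniq_perm; rewrite ?map_inj_uniq ?filter_uniq //; first exact: fmorph_inj.
move=> t; apply/mapP/mem_orbit_in => [[u /mem_orbit_in[uts' [h hH Du]] ->]|[tts [h hH Dt]]].
  split; first exact: (Gts s sG _ uts').
  exists (h ^ s)%g; first by rewrite memJ_norm.
  by rewrite -Du -!galM_full -conjgC.
exists (s^-1%g t); last by rewrite -galM_full mulVg gal_id.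
apply/mem_orbit_in; split; first by apply: Gts; rewrite ?groupV.
exists (h ^ s^-1)%g; first by rewrite memJ_norm ?groupV.
by rewrite -Dt -!galM_full conjgE invgK ?mulgA.
Qed.

(* d is the norm of x0 from K(x0) to K.  Computing the product of the h d in two
   ways, d being in K, avoids counting stabilisers in the last equation. *)
Lemma orbit_prod_mahler (x0 : L) (ts : seq L) :
  map iota ts = conjugate_seq (iota x0) ->
  let d := \prod_(t <- orbit_in ts x0) t in
  [/\ d \in K, mahler (iota d) <= mahler (iota x0), (0 < size (orbit_in ts x0))%N
    & d ^+ #|H| = (\prod_(h in H) (h : gal_of {:L}) x0) ^+ size (orbit_in ts x0)].
Proof.
move=> Dts d.
have uts : uniq ts by rewrite -(map_inj_uniq (fmorph_inj iota)) Dts uniq_conjugate_seq.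
have x0ts : x0 \in ts by rewrite -(mem_map (fmorph_inj iota)) Dts mem_conjugate_seq.
have Gts : {in G, forall s : gal_of {:L}, {in ts, forall t, s t \in ts}}.
  by move=> s sG t; apply: gal_conjugate_seq Dts sG.
have sHG : H \subset G := normal_sub nHG.
pose c r := \prod_(t <- orbit_in ts r) t.
have Gc (s : gal_of {:L}) r : s \in G -> s (c r) = c (s r).
  move=> sG; rewrite /c rmorph_prod -(perm_big _ (perm_map_orbit_in r uts Gts sG)).
  by rewrite big_map.
have Hc (h : gal_of {:L}) : h \in H -> h d = d.
  by move=> hH; rewrite Gc ?(subsetP sHG) // /c orbit_in_eq.
have galK : galois K {:L} by apply: galoisS galL; rewrite sub1v subvf.
split.
- rewrite -(galois_fixedField galK); apply/fixedFieldP; [exact: memvf|exact: Hc].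
- have [p [minp Dp ->]] := conjugate_seqP (iota x0).
  have [lc _ _ _] := minp.
  have lc0 : (lead_coef p)%:~R != 0 :> algC by rewrite intr_eq0 gt_eqF.
  (* The distinct orbits in [gs] partition [ts]. Distinct orbits may have equal products, hence the
     second [undup] in [cs]. *)
  pose gs := undup (map (orbit_in ts) ts).
  pose cs := undup [seq \prod_(t <- s) t | s <- gs].
  have gsP s : s \in gs -> exists2 r, r \in ts & s = orbit_in ts r.
    by rewrite mem_undup => /mapP.
  have pgs : perm_eq ts (flatten gs).
    apply: uniq_perm => //; first apply: uniq_flatten; first exact: undup_uniq.
    - by move=> s /gsP[r _ ->]; apply: filter_uniq.
    - move=> s t x /gsP[r _ ->] /gsP[r' _ ->] /mem_orbit_in[_ [h hH <-]].
      case/mem_orbit_in=> _ [h' hH' E].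
      by rewrite -(orbit_in_eq _ r hH) -E orbit_in_eq.
    move=> t; apply/idP/flattenP => [tts|[s /gsP[r _ ->] /mem_orbit_in[]] //].
    exists (orbit_in ts t); last exact: orbit_in_refl.
    by rewrite mem_undup map_f.
  have csP x : reflect (exists2 r, r \in ts & x = c r) (x \in cs).
    rewrite mem_undup; apply: (iffP mapP) => [[s /gsP[r rts ->] ->]|[r rts ->]].
      by exists r.
    by exists (orbit_in ts r); rewrite // mem_undup map_f.
  have cs1 : \prod_(x <- cs) ('X - x%:P) \is a polyOver 1%VS.
    apply: gal_stable_polyOver1; first exact: undup_uniq.
    move=> s sG _ /csP[r rts ->]; apply/csP.
    by exists (s r); [apply: Gts | apply: Gc].
  have Ecs : map iota cs = undup [seq \prod_(r <- s) r | s <- map (map iota) gs].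
    rewrite -(undup_map_inj (fmorph_inj iota)); congr undup.
    by rewrite -!map_comp; apply: eq_map => s /=; rewrite rmorph_prod big_map.
  have Efl : flatten (map (map iota) gs) = map iota (flatten gs) by rewrite map_flatten.
  have dcs : iota d \in map iota cs by apply: map_f; apply/csP; exists x0.
  (* Grouping the conjugates by orbits and dropping repeated products keeps the coefficients
     integral; they are also rational, [cs] being Galois stable, hence integers. *)
  have Acs : Aint_split (lead_coef p)%:~R (map iota cs).
    rewrite Ecs; apply/Aint_split_undup/Aint_split_flatten; rewrite Efl.
    apply: (perm_Aint_split (perm_map iota pgs)); rewrite /Aint_split Dts -Dp.
    by move=> i; rewrite coef_map Aint_int.
  apply: le_trans (Mahler_of_le (mahlerP (iota d)) lc0 _ dcs) _.
    apply/polyOverP => i; apply: Cint_rat_Aint; last exact: Acs.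
    rewrite coefZ rpredM ?rpred_int // prod_map_poly coef_map.
    by rewrite -Crat_mem1 (polyOverP cs1).
  rewrite gtr0_norm ?ltr0z // ler_pM2l ?ltr0z // Ecs -Dts.
  apply: le_trans (maxprod_undup _) (le_trans (maxprod_flatten _) _).
  by rewrite Efl -(perm_maxprod (perm_map iota pgs)).
- by move: (orbit_in_refl x0ts); case: (orbit_in ts x0).
- transitivity (\prod_(h in H) (h : gal_of {:L}) d).
    by rewrite (eq_bigr (fun=> d)) ?prodr_const // => h /Hc.
  rewrite (eq_bigr (fun h : gal_of {:L} => \prod_(t <- orbit_in ts x0) h t)); last first.
    by move=> h _; rewrite rmorph_prod.
  have pc (s : seq L) x : x ^+ size s = \prod_(t <- s) x.
    by elim: s => [|t s IH]; rewrite ?big_nil // big_cons exprS IH.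
  (* Each [t] in the orbit is [k x0], so that [h t] is [(k * h) x0]; as translation by [k] permutes
     [H], every [t] contributes the same product. *)
  rewrite exchange_big /= pc big_seq [in RHS]big_seq.
  apply: eq_bigr => t /mem_orbit_in[_ [k kH <-]].
  rewrite [RHS](reindex_inj (mulgI k)) /=; apply: eq_big => h; rewrite ?groupMl //.
  by rewrite galM_full.
Qed.

End Galois.

(** * Descent of a factorisation to the Galois closure *)

Lemma separable_rat (L : fieldExtType rat) (K E : {subfield L}) : separable K E.
Proof.
by apply/separableP => x _; apply: pcharf0_separable; apply: ftrans (pchar_lalg L) (pchar_num _).
Qed.

Lemma splitting_galois (L : splittingFieldType rat) (K : {subfield L}) (ts : seq L) :
  \prod_(t <- ts) ('X - t%:P) \is a polyOver 1%VS -> <<1 & ts>>%VS = K -> galois 1 K.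
Proof.
move=> P1 DK; apply/and3P; split; [exact: sub1v | exact: separable_rat |].
apply/(splitting_normalField (sub1v K)).
by exists (\prod_(t <- ts) ('X - t%:P)) => //; exists ts; rewrite ?eqpxx.
Qed.

(** In the intended instance [n] is the order of [H = Gal(L / K)], [nu x] the product of the [h x]
    for [h] in [H], [d] the norm of [x] from [K(x)] to [K], and [k] the orbit size. The last
    equation makes [d] and [nu x] rationally proportional in [V]. Only [algC] is mentioned, so [L]
    can be forgotten. *)
Definition descends (a : algC) (s : seq algC) : Prop :=
  exists (n : nat) (nu : algC -> algC),
    [/\ (0 < n)%N, a ^+ n = \prod_(x <- s) nu x &
      forall x, x \in s -> exists (d : algC) (k : nat),
        [/\ d != 0, in_Kclosure a d, mahler d <= mahler x, (0 < k)%N & d ^+ n = nu x ^+ k]].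

Lemma descends_in (L : splittingFieldType rat) (iota : {rmorphism L -> algC})
    (a : L) (s ta : seq L) :
  galois 1 {:L} -> map iota ta = conjugate_seq (iota a) ->
  {in s, forall x, x != 0 /\ exists tx, map iota tx = conjugate_seq (iota x)} ->
  a = \prod_(x <- s) x -> descends (iota a) (map iota s).
Proof.
move=> galL Dta Ds Da.
pose K := <<1 & ta>>%AS.
have galK1 : galois 1 K by apply: (@splitting_galois L K ta) => //; apply: conjugate_seq_polyOver1 Dta.
have nHG : ('Gal({:L} / K) <| 'Gal({:L} / 1))%g.
  apply: normalField_normal => //; first by rewrite sub1v subvf.
  by case/and3P: galK1.
have aK : a \in K.
  by apply: seqv_sub_adjoin; rewrite -(mem_map (fmorph_inj iota)) Dta mem_conjugate_seq.
pose N (x : L) := \prod_(h in ('Gal({:L} / K))%g) (h : gal_of {:L}) x.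
(* [nu] has to be a function on [algC], so [inv] pulls the members of [map iota s] back to [L]; the
   default 0 is taken only off that list. *)
pose inv y := nth 0 s (index y (map iota s)).
have invK x : x \in s -> inv (iota x) = x.
  by move=> xs; rewrite /inv index_map ?nth_index //; apply: fmorph_inj.
exists #|('Gal({:L} / K))%g|, (fun y => iota (N (inv y))); split.
- exact: cardG_gt0.
(* [H] fixes [a], which lies in [K]; so [N a] is a power of [a], and [N] is multiplicative along
   [s]. *)
- rewrite -rmorphXn; have -> : a ^+ #|('Gal({:L} / K))%g| = N a.
    rewrite /N (eq_bigr (fun=> a)) ?prodr_const // => h hH.
    by rewrite (fixed_gal _ hH) ?subvf.
  rewrite big_map big_seq (eq_bigr (fun x => iota (N x))) => [|x xs]; last by rewrite invK.
  rewrite -big_seq -rmorph_prod; congr (iota _).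
  rewrite /N exchange_big /=; apply: eq_bigr => h _; by rewrite -rmorph_prod -Da.
move=> _ /mapP[x xs ->]; rewrite invK //; have [x0 [tx Dtx]] := Ds x xs.
have [dK dM sz Dd] := orbit_prod_mahler galL nHG Dtx.
set d := \prod_(t <- _) t in dK dM Dd.
exists (iota d), (size (orbit_in K tx x)); split=> //; last by rewrite -!rmorphXn Dd.
- rewrite fmorph_eq0; apply: contraNneq x0 => d0.
  have N0 : N x == 0.
    by move/eqP: Dd; rewrite d0 expr0n gtn_eqF ?cardG_gt0 // eq_sym expf_eq0 sz => /andP[].
  have [h _] := prodf_eq0 _ _ N0.
  by rewrite fmorph_eq0.
- move=> F dF HF; apply: (divring_closed_adjoin dF) dK => t tta.
  have [p [minp Dp _]] := conjugate_seqP (iota a).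
  apply: (HF p) => //; rewrite Dp rootZ; last by case: minp => lc _ _ _; rewrite intr_eq0 gt_eqF.
  by rewrite root_prod_XsubC -Dta map_f.
Qed.

Lemma split_conjugate_seqs (L : fieldExtType rat) (iota : {rmorphism L -> algC})
    (gs : seq algC) (ts : seq L) :
  map iota ts = flatten (map conjugate_seq gs) ->
  \prod_(t <- ts) ('X - t%:P) \is a polyOver 1%VS /\
  {in gs, forall g, exists tg, map iota tg = conjugate_seq g}.
Proof.
elim: gs ts => [|g gs IH] ts /=; first by case: ts => // _; rewrite big_nil rpred1.
move=> Dts; rewrite -[ts](cat_take_drop (size (conjugate_seq g))) big_cat /=.
have D1 : map iota (take (size (conjugate_seq g)) ts) = conjugate_seq g.
  by rewrite map_take Dts take_size_cat.
have D2 : map iota (drop (size (conjugate_seq g)) ts) = flatten (map conjugate_seq gs).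
  by rewrite map_drop Dts drop_size_cat.
have [P2 H2] := IH _ D2; split.
  by rewrite rpredM // (conjugate_seq_polyOver1 D1).
by move=> x; rewrite inE => /predU1P[->|/H2 //]; exists (take (size (conjugate_seq g)) ts).
Qed.

(** [L] is generated by all conjugates of [a] and of its factors, hence is Galois over the
    rationals. *)
Lemma factor_descends (a : algC) (s : seq algC) :
  {in s, forall x, x != 0} -> a = \prod_(x <- s) x -> descends a s.
Proof.
move=> s0 Da.
have [L0 [iota0 [ts Dts genL]]] := num_field_exists (flatten (map conjugate_seq (a :: s))).
have [P1 Hts] := split_conjugate_seqs Dts.
have splitL : SplittingField.axiom L0.
  by exists (\prod_(t <- ts) ('X - t%:P)) => //; exists ts; rewrite ?eqpxx.
pose L : splittingFieldType rat :=
  HB.pack L0 (FieldExt_isSplittingField.Build rat L0 splitL).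
pose iota : {rmorphism L -> algC} := iota0.
have pre g : g \in a :: s -> exists x : L, iota x = g.
  move=> gas; have [tg Dtg] := Hts g gas.
  by have := mem_conjugate_seq g; rewrite -Dtg => /mapP[x _ ->]; exists x.
have [a' Da'] := pre a (mem_head _ _).
have [s' Ds'] : exists s' : seq L, map iota s' = s.
  have {}pre : {in s, forall g, exists x : L, iota x = g}.
    by move=> g gs; apply: pre; rewrite inE gs orbT.
  elim: (s) pre => [|g t IH] pre; first by exists [::].
  have [x Dx] := pre g (mem_head _ _).
  have [|t' Dt'] := IH; first by move=> y yt; apply: pre; rewrite inE yt orbT.
  by exists (x :: t'); rewrite /= Dx Dt'.
have galL : galois 1 {:L} by apply: (@splitting_galois L _ ts).
have [ta Dta] := Hts a (mem_head _ _).
rewrite -Da' -Ds'; apply: (@descends_in L iota a' s' ta) => //; first by rewrite Da'.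
  move=> x xs'; have xs : iota x \in s by rewrite -Ds' map_f.
  split; first by rewrite -(fmorph_eq0 iota) s0.
  by have [|tx Dtx] := Hts (iota x); [rewrite inE xs orbT | exists tx].
by apply: (fmorph_inj iota); rewrite rmorph_prod Da' Da -Ds' big_map.
Qed.

(** * Rational spans and multiplicative generation *)

Lemma torsionXz t (k : int) : torsion t -> torsion (t ^ k).
Proof. by case: k => n tt; rewrite ?NegzE -?exprnN -?exprnP; [|apply: torsionV]; apply: torsionX. Qed.

Section Span.

Variable bs : seq algC.
Hypothesis bs0 : {in bs, forall b, b != 0}.

Let nth_bs0 (i : 'I_(size bs)) : bs`_i != 0. Proof. exact: bs0 (mem_nth 0 (ltn_ord i)). Qed.

Lemma in_spanV_equiv x b : b \in bs -> equivV x b -> in_spanV x bs.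
Proof.
move=> /(nthP 0)[i ltib <-] xb.
exists 1%N, (mkseq (fun j => (j == i)%:Z) (size bs)); rewrite size_mkseq; split=> //.
rewrite expr1 (bigD1 (Ordinal ltib)) //= nth_mkseq // eqxx expr1z big1 ?mulr1 // => j ji.
rewrite nth_mkseq //; suff -> : (j == i :> nat) = false by rewrite expr0z.
by apply: contraNF ji => /eqP ji; apply/eqP/val_inj.
Qed.

Lemma in_spanV1 : in_spanV 1 bs.
Proof.
exists 1%N, (mkseq (fun=> 0) (size bs)); rewrite size_mkseq; split=> //.
rewrite big1 => [|i _]; last by rewrite nth_mkseq // expr0z.
by rewrite expr1n divr1; apply: torsion1.
Qed.

Lemma in_spanV_mul x y : in_spanV x bs -> in_spanV y bs -> in_spanV (x * y) bs.
Proof.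
case=> n [ks [n0 sk xt]] [m [ls [m0 sl yt]]].
exists (n * m)%N, (mkseq (fun i => ks`_i * m%:Z + ls`_i * n%:Z) (size bs)).
rewrite size_mkseq muln_gt0 n0 m0; split=> //.
have -> : \prod_(i < size bs) bs`_i ^ (mkseq (fun i => ks`_i * m%:Z + ls`_i * n%:Z) (size bs))`_i =
   (\prod_(i < size bs) bs`_i ^ ks`_i) ^+ m * (\prod_(i < size bs) bs`_i ^ ls`_i) ^+ n.
  rewrite -!prodrXl -big_split; apply: eq_bigr => i _ /=.
  by rewrite nth_mkseq // expfzDr // -!exprz_exp -!exprnP.
rewrite exprMn exprM mulnC exprM invfM mulrACA -!exprVn -!exprMn.
by apply: torsionM; apply: torsionX.
Qed.

Lemma in_spanV_exp x n : in_spanV x bs -> in_spanV (x ^+ n) bs.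
Proof. by move=> xs; elim: n => [|n IH]; [exact: in_spanV1 | rewrite exprS; apply: in_spanV_mul]. Qed.

Lemma in_spanV_root x n : (0 < n)%N -> in_spanV (x ^+ n) bs -> in_spanV x bs.
Proof.
by move=> n0 [m [ks [m0 sk xt]]]; exists (n * m)%N, ks; rewrite muln_gt0 n0 exprM.
Qed.

(** In additive notation, [pi(a)] is [1/n] times the sum of the [pi(nu x)], and each [pi(nu x)] is
    [n/k] times [pi(d)]. *)
Lemma descends_spanV a s :
  descends a s ->
  (forall x d, x \in s -> d != 0 -> in_Kclosure a d -> mahler d <= mahler x -> in_spanV d bs) ->
  in_spanV a bs.
Proof.
case=> n [nu [n0 Da Hs]] Hd; apply: (in_spanV_root n0); rewrite Da big_seq.
elim/big_ind: _ => [||x xs]; [exact: in_spanV1 | exact: in_spanV_mul |].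
have [d [k [d0 dK dM k0 E]]] := Hs x xs.
by apply: (in_spanV_root k0); rewrite -E; apply: in_spanV_exp; apply: Hd xs d0 dK dM.
Qed.

End Span.

(** * Maxima of Mahler measures and groups generated by elements of small measure *)

Lemma bigmax_mahler_real (s : seq algC) : \big[Num.max/0]_(x <- s) mahler x \is Num.real.
Proof.
elim: s => [|x s IH]; first by rewrite big_nil real0.
by rewrite big_cons /Order.max; case: ifP; rewrite ?mahler_real.
Qed.

Lemma le_bigmax_mahler (s : seq algC) x :
  x \in s -> mahler x <= \big[Num.max/0]_(x <- s) mahler x.
Proof.
elim: s => // y s IH; rewrite inE big_cons comparable_le_max; last first.
  by rewrite real_comparable ?mahler_real ?bigmax_mahler_real.
by case/predU1P=> [->|/IH ->]; rewrite ?lexx ?orbT.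
Qed.

Lemma bigmax_mahler_lt (s : seq algC) y :
  0 < y -> {in s, forall x, mahler x < y} -> \big[Num.max/0]_(x <- s) mahler x < y.
Proof.
move=> y0; elim: s => [|x s IH] H; first by rewrite big_nil.
have lx := H x (mem_head _ _).
have ls : \big[Num.max/0]_(x <- s) mahler x < y.
  by apply: IH => z zs; apply: H; rewrite inE zs orbT.
by rewrite big_cons /Order.max; case: ifP.
Qed.

(** A group, by [mahler_inv]; when [1 < y], its members have M_infty below [y]. *)
Definition mahler_gen (y x : algC) : Prop :=
  exists s : seq algC, {in s, forall z, z != 0 /\ mahler z < y} /\ x = \prod_(z <- s) z.

Section Generated.

Variable y : algC.

Lemma mahler_gen_id x : x != 0 -> mahler x < y -> mahler_gen y x.
Proof. by move=> x0 xy; exists [:: x]; rewrite big_seq1; split=> // z /[!inE] /eqP->. Qed.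

Lemma mahler_gen1 : mahler_gen y 1.
Proof. by exists [::]; rewrite big_nil. Qed.

Lemma mahler_gen_mul u v : mahler_gen y u -> mahler_gen y v -> mahler_gen y (u * v).
Proof.
move=> [s [Hs ->]] [t [Ht ->]]; exists (s ++ t); rewrite big_cat; split=> // z.
by rewrite mem_cat => /orP[/Hs|/Ht].
Qed.

Lemma mahler_gen_inv u : mahler_gen y u -> mahler_gen y u^-1.
Proof.
move=> [s [Hs ->]]; exists (map GRing.inv s); rewrite big_map prodfV; split=> // _ /mapP[z zs ->].
by have [z0 zy] := Hs z zs; rewrite invr_eq0 z0 (le_lt_trans (mahler_inv z0)).
Qed.

Lemma mahler_gen_exp u (k : int) : mahler_gen y u -> mahler_gen y (u ^ k).
Proof.
move=> Hu; have Hn n : mahler_gen y (u ^+ n).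
  by elim: n => [|n IH]; [exact: mahler_gen1 | rewrite exprS; apply: mahler_gen_mul].
by case: k => n; rewrite ?NegzE -?exprnN -?exprnP //; apply: mahler_gen_inv.
Qed.

Lemma mahler_gen_neq0 u : mahler_gen y u -> u != 0.
Proof. by move=> [s [Hs ->]]; rewrite prodf_seq_neq0; apply/allP => z /Hs[]. Qed.

(** With [c_i] an [n]-th root of [z_i b_i], the product [w] of the [c_i^(k_i)] agrees with [a] up to
    a root of unity, whose measure is at most 1 and so below [y]. *)
Lemma spanV_mahler_gen a bs :
  a != 0 -> {in bs, forall b, b != 0} -> 1 < y ->
  {in bs, forall b, exists z, torsion z /\ mahler (z * b) < y} ->
  in_spanV a bs -> mahler_gen y a.
Proof.
move=> a0 bs0 y1 Hbs [n [ks [n0 sk ta]]].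
pose Q v := exists w, mahler_gen y w /\ torsion (w ^+ n / v).
have [w [gw tw]] : Q (\prod_(i < size bs) bs`_i ^ ks`_i).
  elim/big_ind: _ => [|u v [w [gw tw]] [x [gx tx]]|i _].
  - by exists 1; split; [exact: mahler_gen1 | rewrite expr1n divr1; exact: torsion1].
  - exists (w * x); split; first exact: mahler_gen_mul.
    by rewrite exprMn invfM mulrACA; apply: torsionM.
  have bsi : bs`_i \in bs by rewrite mem_nth.
  have b0 := bs0 _ bsi; have [z [tz zy]] := Hbs _ bsi.
  have z0 := torsion_neq0 tz.
  pose c := n.-root (z * bs`_i); have Dc : c ^+ n = z * bs`_i by rewrite rootCK.
  have c0 : c != 0.
    have : c ^+ n != 0 by rewrite Dc mulf_neq0.
    by rewrite expf_eq0 n0.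
  exists (c ^ ks`_i); split.
    by apply/mahler_gen_exp/mahler_gen_id => //; apply: le_lt_trans (mahler_exp_ge n0 Dc) zy.
  have -> : (c ^ ks`_i) ^+ n = (z * bs`_i) ^ ks`_i.
    by rewrite -Dc !exprnP !exprz_exp mulrC.
  by rewrite expfzMl mulfK ?expfz_neq0 //; apply: torsionXz.
have w0 := mahler_gen_neq0 gw.
rewrite -[a](divfK w0); apply: mahler_gen_mul => //.
have tt : torsion (a / w).
  apply: (torsion_root n0).
  have v0 : \prod_(i < size bs) bs`_i ^ ks`_i != 0.
    by have := torsion_neq0 ta; rewrite mulf_eq0 invr_eq0 => /norP[].
  have -> : (a / w) ^+ n = (a ^+ n / \prod_(i < size bs) bs`_i ^ ks`_i) /
      (w ^+ n / \prod_(i < size bs) bs`_i ^ ks`_i).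
    by rewrite invf_div mulrA mulfVK // exprMn exprVn.
  by apply: torsionM => //; apply: torsionV.
apply: mahler_gen_id; first exact: torsion_neq0.
exact: le_lt_trans (mahler_torsion tt) y1.
Qed.

End Generated.

(** * Comparison of the two infima through lower bounds *)

Lemma inf_le_chain (bs : seq algC) i j :
  (forall i, (i.+1 < size bs)%N -> inf_le (MbarSet bs`_i) (MbarSet bs`_i.+1)) ->
  (i <= j < size bs)%N -> inf_le (MbarSet bs`_i) (MbarSet bs`_j).
Proof.
move=> mono /andP[leij]; rewrite -(subnKC leij); elim: (j - i)%N => [|k IH]; first by rewrite addn0 => _ y.
by rewrite addnS => lt y /(IH (ltnW lt)); apply: mono.
Qed.

Lemma in_Kclosure_id a : in_Kclosure a a.
Proof.
move=> F _ HF; have [p [minp Dp _]] := conjugate_seqP a.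
by apply: (HF p) => //; case: minp.
Qed.

Theorem mainTheorem1 (a : algC) (bs : seq algC) (J : nat) :
  a != 0 ->
  (* bs lists representatives b_1, ..., b_N of Bbar(a), without repetition *)
  (forall i, (i < size bs)%N -> Bset a bs`_i) ->
  (forall g, Bset a g -> exists2 i, (i < size bs)%N & equivV g bs`_i) ->
  (forall i j, (i < size bs)%N -> (j < size bs)%N -> equivV bs`_i bs`_j -> i = j) ->
  (* Mbar(b_1) <= Mbar(b_2) <= ... <= Mbar(b_N) *)
  (forall i, (i.+1 < size bs)%N -> inf_le (MbarSet bs`_i) (MbarSet bs`_i.+1)) ->
  (* J is the smallest index with pi(a) in span{b_1, ..., b_J} *)
  (0 < J <= size bs)%N ->
  in_spanV a (take J bs) ->
  (forall J', (0 < J' < J)%N -> ~ in_spanV a (take J' bs)) ->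
  (* M_infty(a) = Mbar(b_J) *)
  inf_eq (MinfSet a) (MbarSet bs`_J.-1).
Proof.
move=> a0 bsB Bbs _ mono /andP[J0 leJ] aJ minJ.
have bs0 : {in bs, forall b, b != 0}.
  by move=> b /(nthP 0)[i lti <-]; case: (bsB i lti).
have take0 k : {in take k bs, forall b, b != 0} by move=> b /mem_take /bs0.
(* Positions start at 0: [b_J] sits at [j], and [take j bs] is what precedes it. *)
set j := J.-1; have DJ : J = j.+1 by rewrite prednK.
have ltj : (j < size bs)%N by rewrite -DJ.
split=> y lby.
- move=> _ [z [tz ->]].
  (* The order of [algC] is partial; the trivial factorisation [[:: a]] compares [y] with a real
     number. *)
  have yreal : y \is Num.real.
    have : y <= \big[Num.max/0]_(x <- [:: a]) mahler x.
      by apply: lby; exists [:: a]; rewrite big_seq1 /= a0.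
    by move/ler_real->; rewrite bigmax_mahler_real.
  (* Otherwise a twist of [b_J] by a root of unity measures less than [y]. By monotonicity of Mbar
     so does a twist of each earlier [b_i], and these generate [a]. *)
  have [//|lt_y] := real_leP yreal (mahler_real (z * bs`_j)).
  have y1 : 1 < y := le_lt_trans (mahler_ge1 _) lt_y.
  have [s [Hs Da]] : mahler_gen y a.
    apply: spanV_mahler_gen aJ => // b /(nthP 0)[i lti <-].
    move: lti; rewrite size_take_min leq_min => /andP[ltiJ ltib]; rewrite nth_take //.
    apply: NNPP => nz.
    have /(_ (mahler (z * bs`_j))) : lbound (MbarSet bs`_j) y.
      apply: (@inf_le_chain bs i j mono); first by rewrite -ltnS -DJ ltiJ.
      move=> _ [w [tw ->]]; rewrite real_leNgt ?mahler_real //.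
      by apply/negP => lw; apply: nz; exists w.
    by rewrite lt_geF // => /(_ (ex_intro _ z (conj tz erefl))).
  (* The extra factor 1 keeps the list non-empty, as [MinfSet] demands. *)
  have : y <= \big[Num.max/0]_(x <- 1 :: s) mahler x.
    apply: lby; exists (1 :: s); split=> //=; last by rewrite big_cons mul1r.
    by rewrite oner_neq0; apply/allP => x /Hs[].
  rewrite lt_geF //; apply: bigmax_mahler_lt; first exact: lt_trans ltr01 y1.
  move=> x; rewrite inE => /predU1P[->|/Hs[] //].
  exact: le_lt_trans (mahler_torsion torsion1) y1.
- move=> _ [s [s0 nzs Da ->]]; set m := \big[_/_]_(x <- s) _.
  (* Let [b_i] represent the class of [d]. If [j <= i], then [y] bounds Mbar of [b_i], hence
     [mahler d]; otherwise [d] lies in the smaller span. The conjunct [0 < j] is recorded because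
     [minJ] speaks of positive indices. *)
  have key d : Bset a d -> y <= mahler d \/ (0 < j)%N /\ in_spanV d (take j bs).
    move=> Bd; have [d0 _ _] := Bd; have [i lti dbi] := Bbs d Bd.
    have b0 : bs`_i != 0 by apply: bs0; rewrite mem_nth.
    have [leji|ltij] := leqP j i.
      left; rewrite -[d](divfK b0); apply: (@inf_le_chain bs j i mono) => //; first by rewrite leji.
      by exists (d / bs`_i).
    right; split; first exact: leq_ltn_trans ltij.
    apply: (in_spanV_equiv _ dbi); rewrite -(nth_take 0 ltij) mem_nth //.
    by rewrite size_take_min leq_min ltij.
  have nspan : (0 < j)%N -> ~ in_spanV a (take j bs).
    by move=> j0; apply: minJ; rewrite j0 DJ /=.
  (* If the factorisation measures at least as much as [a], then [key] applies to [a] itself, which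
     is outside the smaller span. *)
  have [le_am|lt_ma] := real_leP (mahler_real a) (bigmax_mahler_real s).
    have [|y_a|[j0 /(nspan j0)] //] := key a; last exact: le_trans y_a le_am.
    by split=> //; apply: in_Kclosure_id.
  have nz x : x \in s -> x != 0 by move/(allP nzs).
  (* If all factors measure less than [y], so do the descended [d]; these then lie in the span of
     [take j bs], and so does [a], against the minimality of [J]. *)
  have [/hasP[x xs yx]|/hasPn ny] := boolP (has (fun x => y <= mahler x) s).
    exact: le_trans yx (le_bigmax_mahler xs).
  have Hd x d : x \in s -> d != 0 -> in_Kclosure a d -> mahler d <= mahler x ->
      (0 < j)%N /\ in_spanV d (take j bs).
    move=> xs d0 dK dx; have [|yd|//] := key d.
      split=> //; apply: le_trans dx (le_trans (le_bigmax_mahler xs) (ltW lt_ma)).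
    by have := ny x xs; rewrite (le_trans yd dx).
  have desc := factor_descends nz Da.
  have j0 : (0 < j)%N.
    have [n [nu [_ _ H]]] := desc.
    have xs : head 0 s \in s by case: (s) s0 => //= x t _; rewrite mem_head.
    by have [d [k [d0 dK dM _ _]]] := H _ xs; have [] := Hd _ _ xs d0 dK dM.
  case: (nspan j0); apply: (descends_spanV (take0 j) desc) => x d xs d0 dK dM.
  by have [] := Hd _ _ xs d0 dK dM.
Qed.
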